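(* Let $\mathbb{X}=(X,d_X,\mu)$, $\mathbb{Y}=(Y,d_Y,\nu)$ be mm-spaces with $|\mu|=|\nu|>0$, let $r\ge1$, and suppose $\lambda>0$ satisfies $$2\lambda\ \ge\ \omega_1\frac{1}{\min(|\mu|,|\nu|)}\max_{x\in X,\,y\in Y}C(x,y)+\omega_2\max_{x,x'\in X,\,y,y'\in Y}L\left(d_X^r(x,x'),d_Y^r(y,y')\right).$$ Then $$FPGW_{r,L,\lambda}(\mathbb{X},\mathbb{Y})=FGW_{r,L}(\mathbb{X},\mathbb{Y}).$$
   Context: An mm-space $\mathbb{X}=(X,d_X,\mu)$ is a compact set $X$ with a metric $d_X$ and a finite nonnegative Borel measure $\mu$ with $\operatorname{supp}(\mu)=X$. $|\sigma|$ denotes the total mass of $\sigma$. $C:X\times Y\to\mathbb{R}_+$ and $L:\mathbb{R}^2\to\mathbb{R}_+$ are lower semicontinuous (with the maxima in the claim existing), and $\omega_1,\omega_2\ge0$, $\omega_1+\omega_2=1$. For $\gamma\in\mathcal{M}_+(X\times Y)$ (finite nonnegative Radon measures) with marginals $\gamma_1,\gamma_2$, put $\gamma(C)=\int C\,d\gamma$ and $\gamma^{\otimes2}(L(d_X^r,d_Y^r))=\int_{(X\times Y)^2}L(d_X(x,x')^r,d_Y(y,y')^r)\,d\gamma(x,y)d\gamma(x',y')$. $\Gamma(\mu,\nu)=\{\gamma\in\mathcal{M}_+(X\times Y):\gamma_1=\mu,\gamma_2=\nu\}$ and $\Gamma_\le(\mu,\nu)=\{\gamma\in\mathcal{M}_+(X\times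 Y):\gamma_1\le\mu,\gamma_2\le\nu\}$ (setwise domination on Borel sets). Fused Gromov–Wasserstein: $FGW_{r,L}(\mathbb{X},\mathbb{Y})=\inf_{\gamma\in\Gamma(\mu,\nu)}\omega_1\gamma(C)+\omega_2\gamma^{\otimes2}(L(d_X^r,d_Y^r))$. Fused partial Gromov–Wasserstein: $FPGW_{r,L,\lambda}(\mathbb{X},\mathbb{Y})=\inf_{\gamma\in\Gamma_\le(\mu,\nu)}\omega_1\gamma(C)+\omega_2\gamma^{\otimes2}(L(d_X^r,d_Y^r))+\lambda(|\mu|^2+|\nu|^2-2|\gamma|^2)$. *)

(* Defs.v *)
From HB Require Import structures.
From mathcomp Require Import all_boot all_order all_algebra.
From mathcomp Require Import all_classical all_reals all_analysis.
Set Implicit Arguments.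
Unset Strict Implicit.
Unset Printing Implicit Defensive.
Import Order.TTheory GRing.Theory Num.Theory.
Import numFieldNormedType.Exports.
Local Open Scope classical_set_scope.
Local Open Scope ring_scope.

(* Measurable types are pointed in MathComp-Analysis, so a metric space that
   carries a measure must come with a point. This only excludes the empty
   space; the point itself is used nowhere. *)
#[short(type="pmetricType")]
HB.structure Definition PMetric (R : numDomainType) :=
  {M of Metric R M & Pointed M}.

(* Makes the product of two ptopologicalTypes a ptopologicalType. *)
HB.saturate prod.

Notation borel T := (g_sigma_algebraType (open : set (set T))).

Definition measure_support (R : realType) (T : ptopologicalType)
    (mu : {measure set (borel T) -> \bar R}) : set T :=
  [set x | forall U : set T, open U -> U x -> (0 < mu U)%E].

(* A finite Borel measure is Radon when it is inner regular for compact sets;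
   local finiteness is automatic. *)
Definition radon (R : realType) (T : ptopologicalType)
    (m : {finite_measure set (borel T) -> \bar R}) : Prop :=
  forall A : set (borel T), measurable A ->
    m A = ereal_sup [set m K | K in [set K : set T | compact K /\ K `<=` A]].

Definition mass (R : realType) (d : measure_display) (T : measurableType d)
    (m : {finite_measure set T -> \bar R}) : R := fine (m setT).

Record mmSpace (R : realType) := MMSpace {
  mm_space :> pmetricType R ;
  mm_measure : {finite_measure set (borel mm_space) -> \bar R} ;
  mm_compact : compact [set: mm_space] ;
  mm_support : measure_support mm_measure = [set: mm_space]
}.

Definition is_maximum (R : realType) (T : Type) (f : T -> R) (m : R) : Prop :=
  (exists t, f t = m) /\ (forall t, f t <= m).

Section fused_gromov_wasserstein.
Context {R : realType} (X Y : mmSpace R).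

Notation plan := {finite_measure set (borel (X * Y)%type) -> \bar R}.

Definition marginal1 (g : plan) : set (borel X) -> \bar R :=
  pushforward g (fst : borel (X * Y)%type -> borel X).

Definition marginal2 (g : plan) : set (borel Y) -> \bar R :=
  pushforward g (snd : borel (X * Y)%type -> borel Y).

Definition couplings : set plan :=
  [set g | [/\ radon g,
     forall A, measurable A -> marginal1 g A = mm_measure X A &
     forall B, measurable B -> marginal2 g B = mm_measure Y B]].

Definition partial_couplings : set plan :=
  [set g | [/\ radon g,
     forall A, measurable A -> (marginal1 g A <= mm_measure X A)%E &
     forall B, measurable B -> (marginal2 g B <= mm_measure Y B)%E]].

Definition distortion (L : R * R -> R) (r : R) (z z' : X * Y) : R :=
  L (mdist z.1 z'.1 `^ r, mdist z.2 z'.2 `^ r).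

Definition fused_cost (C : X * Y -> R) (L : R * R -> R) (w1 w2 r : R)
    (g : plan) : \bar R :=
  (w1%:E * (\int[g]_z (C z)%:E) +
   w2%:E * (\int[g \x g]_zz (distortion L r zz.1 zz.2)%:E))%E.

Definition FGW (C : X * Y -> R) (L : R * R -> R) (w1 w2 r : R) : \bar R :=
  ereal_inf [set fused_cost C L w1 w2 r g | g in couplings].

Definition FPGW (C : X * Y -> R) (L : R * R -> R) (w1 w2 r lam : R) : \bar R :=
  ereal_inf [set (fused_cost C L w1 w2 r g +
    (lam * (mass (mm_measure X) ^+ 2 + mass (mm_measure Y) ^+ 2 -
            2 * mass g ^+ 2))%:E)%E | g in partial_couplings].

End fused_gromov_wasserstein.

Arguments couplings {R} X Y.
Arguments partial_couplings {R} X Y.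
Arguments fused_cost {R} X Y C L w1 w2 r g.
Arguments FGW {R} X Y C L w1 w2 r.
Arguments FPGW {R} X Y C L w1 w2 r lam.

(* Main.v *)
Require Import Defs.
From HB Require Import structures.
From mathcomp Require Import all_boot all_order all_algebra.
From mathcomp Require Import all_classical all_reals all_analysis.
From mathcomp Require Import ring lra measurable_realfun.
Set Implicit Arguments.
Unset Strict Implicit.
Unset Printing Implicit Defensive.
Import Order.TTheory GRing.Theory Num.Theory.
Import numFieldNormedType.Exports.
Local Open Scope classical_set_scope.
Local Open Scope ring_scope.

(* FPGW <= FGW because a coupling is a partial coupling of full mass, for which
   the penalty vanishes. Conversely, a partial coupling g of mass m, with
   M = |mu| = |nu|, is completed into the coupling
     g' = g + (M - m)^-1 (mu - g_1) \x (nu - g_2).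
   This raises the linear term by at most Cmax (M - m) and the quadratic term
   by at most Lmax (M^2 - m^2), and the bound on lambda says that the saved
   penalty 2 lambda (M^2 - m^2) pays for both. The completion g' is a Radon
   measure on the Borel sets of X * Y: by compactness X and Y are second
   countable, so that open sets of X * Y are measurable for the product
   sigma-algebra, and finite Borel measures on compact metric spaces are
   Radon. *)

(** * Finite measures *)

Lemma massE d (T : measurableType d) (R : realType)
    (m : {finite_measure set T -> \bar R}) :
  (mass m)%:E = m setT.
Proof. by rewrite fineK// fin_num_measure. Qed.

Lemma mass_ge0 d (T : measurableType d) (R : realType)
    (m : {finite_measure set T -> \bar R}) :
  0 <= mass m.
Proof. by rewrite fine_ge0. Qed.

Section finite_measure_of_measure.
Context d (T : measurableType d) (R : realType).
Variable m : {measure set T -> \bar R}.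
Hypothesis mT : (m setT < +oo)%E.

Let m' : set T -> \bar R := m.

Let m'_fin : fin_num_fun m'.
Proof.
move=> A mA; rewrite ge0_fin_numE ?measure_ge0//; apply: le_lt_trans mT.
by apply: le_measure => //; rewrite inE.
Qed.

HB.instance Definition _ := Measure.on m'.
HB.instance Definition _ := Measure_isFinite.Build _ _ _ m' m'_fin.

Lemma finite_measure_of_measure :
  exists m' : {finite_measure set T -> \bar R}, m' = m :> (set T -> \bar R).
Proof. by exists m'. Qed.

End finite_measure_of_measure.

Lemma pushforward_finite_measure d d' (T1 : measurableType d)
    (T2 : measurableType d') (R : realType)
    (m : {measure set T1 -> \bar R}) (f : T1 -> T2) :
  measurable_fun setT f -> (m setT < +oo)%E ->
  exists m' : {finite_measure set T2 -> \bar R},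
    m' = pushforward m f :> (set T2 -> \bar R).
Proof.
move=> mf mT.
have [p pE] : exists p : {measure set T2 -> \bar R},
    p = pushforward m f :> (set T2 -> \bar R).
  by unshelve (exists (pushforward m f)).
have [|m' m'E] := @finite_measure_of_measure _ T2 R p; first by rewrite pE.
by exists m'; rewrite m'E.
Qed.

Section measure_difference.
Local Open Scope ereal_scope.
Context d (T : measurableType d) (R : realType).
Variables m1 m2 : {finite_measure set T -> \bar R}.
Hypothesis m21 : forall A, measurable A -> m2 A <= m1 A.

(* Truncated at 0 since a measure has to be nonnegative on all sets,
   measurable or not. *)
Let diff (A : set T) := maxe 0 (m1 A - m2 A).

Let diffE A : measurable A -> diff A = m1 A - m2 A.
Proof.
by move=> mA; apply/max_idPr; rewrite sube_ge0 ?m21// fin_num_measure.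
Qed.

Let diff0 : diff set0 = 0.
Proof. by rewrite diffE// !measure0 sube0. Qed.

Let diff_ge0 A : 0 <= diff A.
Proof. by rewrite /diff le_max lexx. Qed.

Let diff_sigma_additive : semi_sigma_additive diff.
Proof.
move=> F mF tF mUF; rewrite diffE//.
rewrite (_ : (fun _ => _) = (fun n => \sum_(0 <= i < n) m1 (F i)
    - \sum_(0 <= i < n) m2 (F i))); last first.
  apply/funext => n; elim: n => [|n IHn]; first by rewrite !big_geq// sube0.
  rewrite !big_nat_recr//= IHn diffE//; set a := \sum_(_ <= _ < _) _.
  set b := \sum_(_ <= _ < _) _.
  by rewrite (@fin_num_oppeD _ b) ?fin_num_measure// addeACA.
apply: cvgeB.
- by rewrite fin_num_adde_defl// fin_numN fin_num_measure.
- exact: measure_semi_sigma_additive.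
- exact: measure_semi_sigma_additive.
Qed.

HB.instance Definition _ :=
  isMeasure.Build _ _ _ diff diff0 diff_ge0 diff_sigma_additive.

(** The additive form avoids subtraction of extended reals. It is confined to measurable sets, where
    the domination makes the truncation invisible. *)
Lemma measure_difference :
  exists m : {finite_measure set T -> \bar R},
    forall A, measurable A -> m1 A = m2 A + m A.
Proof.
have dT : diff setT < +oo.
  by rewrite diffE// ltey_eq fin_numB !fin_num_measure.
have [m mE] := @finite_measure_of_measure _ T R diff dT.
exists m => A mA; have -> : m A = m1 A - m2 A by rewrite mE; exact: diffE.
by rewrite addeC subeK// fin_num_measure.
Qed.

End measure_difference.

Section integral_measure_add_le.
Import HBNNSimple.

(* The integral of a possibly non-measurable f >= 0 is the supremum of the
   integrals of the simple functions below it, which is only subadditive in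
   the measure. *)
Lemma integral_measure_add_le d (T : measurableType d) (R : realType)
    (m m1 m2 : {measure set T -> \bar R}) (f : T -> R) (M : R) :
  (forall A, measurable A -> m A = (m1 A + m2 A)%E) ->
  (forall x, 0 <= f x) -> (forall x, f x <= M) ->
  (\int[m]_x (f x)%:E <= \int[m1]_x (f x)%:E + M%:E * m2 setT)%E.
Proof.
move=> mE f0 fM.
rewrite [leLHS]ge0_integralTE; last by move=> x; rewrite lee_fin.
(* For a simple [h] below [f], additivity in the measure is exact. The [m1] part is then bounded by
   the supremum defining the integral of [f], the [m2] part by the constant [M]. *)
apply: ge_ereal_sup => _ [h /= hf <-].
rewrite -integralT_nnsfun (eq_measure_integral (measure_add m1 m2)); last first.
  by move=> A mA _; rewrite mE//; exact/esym/measure_addE.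
rewrite ge0_integral_measure_add//; last 2 first.
  by move=> x _; rewrite lee_fin.
  exact/measurable_EFinP.
apply: leeD.
  rewrite integralT_nnsfun ge0_integralTE; last by move=> x; rewrite lee_fin.
  by apply: ereal_sup_ubound; exists h.
rewrite -integral_cst//; apply: ge0_le_integral => //.
- by move=> x _; rewrite lee_fin.
- exact/measurable_EFinP.
- by move=> x _; rewrite /= (le_trans (hf x))// lee_fin.
Qed.

End integral_measure_add_le.

(** Splitting the left factor gives [Q \x P + N \x P]; the right factor is then split in the first
    term only, which isolates [Q \x Q] with two error terms. *)
Lemma product_measure_add d (T : measurableType d) (R : realType)
    (P Q N : {finite_measure set T -> \bar R}) :
  (forall A, measurable A -> P A = (Q A + N A)%E) ->
  forall A, measurable A ->
    (P \x P)%E A = ((Q \x Q)%E A + ((Q \x N)%E A + (N \x P)%E A))%E.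
Proof.
move=> PE A mA; rewrite /product_measure1.
have mx (m : {finite_measure set T -> \bar R}) :
    measurable_fun setT (m \o xsection A) by exact: measurable_fun_xsection.
rewrite (eq_measure_integral (measure_add Q N)); last first.
  by move=> B mB _; rewrite PE//; exact/esym/measure_addE.
rewrite ge0_integral_measure_add// addeA; congr (_ + _)%E.
rewrite -ge0_integralD//.
by apply: eq_integral => x _ /=; rewrite PE//; exact: measurable_xsection.
Qed.

(** * Borel measures on compact metric spaces *)

Section borel_regularity.
Context (R : realType) (T : pseudoPMetricType R).
Variable m : {finite_measure set (borel T) -> \bar R}.

(** Two-sided regularity, closed inside and open outside, is stable under complement, unlike inner
    regularity alone. These sets thus form a sigma-algebra, and it contains the open sets. *)
Let approx (A : set (borel T)) := measurable A /\
  forall e : R, 0 < e -> exists K U : set T,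
    [/\ closed K, open U, K `<=` A, A `<=` U & (m (U `\` K) < e%:E)%E].

Let open_measurable_borel (U : set T) :
  open U -> measurable (U : set (borel T)).
Proof. exact: sub_sigma_algebra. Qed.

Let closed_measurable_borel (K : set T) :
  closed K -> measurable (K : set (borel T)).
Proof.
move=> cK; rewrite -[K]setCK; apply: (@measurableC _ (borel T)).
by apply: open_measurable_borel; exact: closed_openC.
Qed.

(** Continuity from above, available because [m] is finite. Only a bound on a set [V] containing the
    intersection is asked for. *)
Let cvg0_lt (F : (set (borel T))^nat) (V : set (borel T)) (e : R) :
  (forall n, measurable (F n)) -> measurable V ->
  {homo F : n k / (n <= k)%N >-> (k <= n)%O} ->
  \bigcap_n F n `<=` V -> (m V < e%:E)%E -> exists n, (m (F n) < e%:E)%E.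
Proof.
move=> mF mV dF FV mVe.
have mI : measurable (\bigcap_n F n) by exact: bigcapT_measurable.
have := @nonincreasing_cvg_mu _ _ _ m F _ mF mI dF.
have F0 : (m (F 0%N) < +oo)%E by rewrite ltey_eq fin_num_measure.
have lte : (m (\bigcap_n F n) < e%:E)%E.
  by apply: le_lt_trans mVe; apply: le_measure => //; rewrite inE.
move=> /(_ F0 _ (open_ereal_lt' lte))[N _ FN].
by exists N; exact: FN (leqnn N).
Qed.

Let approx_open (A : set T) : open A -> approx A.
Proof.
move=> oA; split; first exact: open_measurable_borel.
move=> e e0.
pose W (n : nat) := \bigcup_(y in ~` A) (ball y n.+1%:R^-1)° : set T.
have oW n : open (W n) by apply: bigcup_open => y _; exact: open_interior.
have ninv (n : nat) : (0 : R) < n.+1%:R^-1 by rewrite invr_gt0.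
have [n Wn] : exists n, (m (A `&` W n) < e%:E)%E.
  apply: (@cvg0_lt _ set0) => //.
  - move=> n; apply: measurableI; exact: open_measurable_borel.
  - move=> n k nk; apply/subsetPset; apply: setIS => x [y Ay yx].
    exists y => //; move: yx; apply: interiorS => z.
    by apply: le_ball; rewrite lef_pV2 ?posrE// ler_nat.
  - move=> x Ix; have [Ax _] := Ix 0%N I.
    have /nbhs_ballP[r /= r0 rA] : nbhs x A by exact: open_nbhs_nbhs.
    have [k kr] : exists k : nat, k.+1%:R^-1 < r.
      have := near_infty_natSinv_lt (PosNum r0).
      by move=> [k _ /(_ k (leqnn k))] /= kr; exists k.
    have [_ [y Ay /interior_subset yx]] := Ix k I.
    by apply: Ay; apply: rA; apply: (le_ball (ltW kr)); exact: ball_sym.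
  - by rewrite measure0.
exists (~` W n), A; split => //.
- exact: open_closedC.
- move=> x Wx; apply: contrapT => Ax; apply: Wx; exists x => //.
  exact: nbhsx_ballx.
- by rewrite setDE setCK.
Qed.

Let approx_set0 : approx set0.
Proof. by apply: approx_open; exact: open0. Qed.

Let approx_setC A : approx A -> approx (~` A).
Proof.
move=> [mA aA]; split; first exact: measurableC.
move=> e e0; have [K [U [cK oU KA AU KU]]] := aA e e0.
exists (~` U), (~` K); split; [exact: open_closedC|exact: closed_openC| | |].
- exact: subsetC.
- exact: subsetC.
- by rewrite setDE setCK setIC -setDE.
Qed.

Let approx_bigcup (A : (set T)^nat) :
  (forall n, approx (A n)) -> approx (\bigcup_n A n).
Proof.
move=> aA; split; first by apply: bigcupT_measurable => n; case: (aA n).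
move=> e e0; have e20 : 0 < e / 2 by rewrite divr_gt0.
(* These errors sum to e/2, which leaves room for the strict bound by e. *)
pose del (n : nat) := (e / 2) / (2 ^ n.+1)%:R.
have del0 n : 0 < del n by rewrite divr_gt0// ltr0n expn_gt0.
have /choice[KU KUP] : forall n, exists KU : set T * set T,
    [/\ closed KU.1, open KU.2, KU.1 `<=` A n, A n `<=` KU.2 &
        (m (KU.2 `\` KU.1) < (del n)%:E)%E].
  by move=> n; have [K [U KU]] := (aA n).2 (del n) (del0 n); exists (K, U).
pose K n := (KU n).1; pose U n := (KU n).2.
have cK n : closed (K n) by have [] := KUP n.
have oU n : open (U n) by have [] := KUP n.
have mK n : measurable (K n : set (borel T)) by exact: closed_measurable_borel.
have mU n : measurable (U n : set (borel T)) by exact: open_measurable_borel.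
have oUU : open (\bigcup_n U n) by exact: bigcup_open.
(* The union of all [K n] need not be closed, so it is cut at a finite stage, found by continuity
   from above. *)
have cKn n : closed (\big[setU/set0]_(i < n) K i) by exact: closed_bigsetU.
have [n Kn] : exists n,
    (m (\bigcup_n U n `\` \big[setU/set0]_(i < n) K i) < e%:E)%E.
  apply: (@cvg0_lt _ (\bigcup_n (U n `\` K n))).
  - move=> n; apply: measurableD; first exact: open_measurable_borel.
    exact: closed_measurable_borel.
  - by apply: bigcupT_measurable => n; exact: measurableD.
  - by move=> i k ik; apply/subsetPset; apply: setDS; exact: subset_bigsetU.
  - move=> x Ix; have [[i _ Ui] _] := Ix 0%N I; exists i => //; split => // Ki.
    (* The union over indices below [n] first contains [K i] at [n = i + 1]. *)
    by have [_] := Ix i.+1 I; apply; rewrite big_ord_recr/=; right.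
  - apply: (@le_lt_trans _ _ (e / 2)%:E); last first.
      by rewrite lte_fin ltr_pdivrMr// ltr_pMr// ltr1n.
    apply: le_trans (epsilon_trick0 xpredT (ltW e20)).
    apply: le_trans (generalized_Boole_inequality _ _ _) _ => //.
    + by move=> i; exact: measurableD.
    + by apply: bigcupT_measurable => i; exact: measurableD.
    + by apply: lee_nneseries => // i _; have [_ _ _ _ /ltW] := KUP i.
exists (\big[setU/set0]_(i < n) K i), (\bigcup_n U n); split => //.
- rewrite -bigcup_mkord => x [i _ Kx]; exists i => //.
  by have [_ _ KA _ _] := KUP i; exact: KA.
- by apply: subset_bigcup => i _; have [] := KUP i.
Qed.

Let approx_measurable (A : set (borel T)) : measurable A -> approx A.
Proof.
apply: smallest_sub; last by move=> U; exact: approx_open.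
by split; [exact: approx_set0|move=> B; rewrite setTD; exact: approx_setC
          |exact: approx_bigcup].
Qed.

(** In a compact space the closed inner approximations are compact. Hausdorff separation serves the
    other inequality: it makes compact sets closed, hence measurable. *)
Lemma compact_metric_radon :
  hausdorff_space T -> compact [set: T] -> radon m.
Proof.
move=> hT cT A mA; apply/eqP; rewrite eq_le; apply/andP; split; last first.
  apply: ge_ereal_sup => _ [K [cK KA] <-]; apply: le_measure => //; rewrite inE//.
  by apply: closed_measurable_borel; exact: compact_closed.
apply/lee_addgt0Pr => e e0.
have [_ /(_ e e0)[K [U [cK oU KA AU UK]]]] := @approx_measurable A mA.
have mK := @closed_measurable_borel K cK; have mU := @open_measurable_borel U oU.
apply: (@le_trans _ _ (m K + m (U `\` K))%E).
  apply: (@le_trans _ _ (m (K `|` (U `\` K)))); last first.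
    exact: measureU2 (measurableD mU mK).
  apply: le_measure; rewrite ?inE//; first exact/measurableU/measurableD.
  by move=> x /AU Ux; case: (pselect (K x)) => Kx; [left|right].
apply: leeD; last exact: ltW.
apply: ereal_sup_ubound; exists K => //; split => //.
exact: subclosed_compact cK cT _.
Qed.

End borel_regularity.

(** * Separation and Borel sets in products *)

Lemma hausdorff_space_prod (U V : topologicalType) :
  hausdorff_space U -> hausdorff_space V -> hausdorff_space (U * V)%type.
Proof.
move=> hU hV [x1 x2] [y1 y2] xy; congr (_, _).
  apply: hU => A B xA yB.
  have [[z1 z2] [/= zA zB]] := xy (A `*` setT) (B `*` setT)
    ltac:(by exists (A, setT) => //; split => //; exact: filterT)
    ltac:(by exists (B, setT) => //; split => //; exact: filterT).
  by exists z1; split; [case: zA|case: zB].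
apply: hV => A B xA yB.
have [[z1 z2] [/= zA zB]] := xy (setT `*` A) (setT `*` B)
  ltac:(by exists (setT, A) => //; split => //; exact: filterT)
  ltac:(by exists (setT, B) => //; split => //; exact: filterT).
by exists z2; split; [case: zA|case: zB].
Qed.

(** Countable bases make every open set of the product a countable union of open boxes, each of
    which is measurable for the product sigma-algebra. *)
Lemma second_countable_borel_prod (U V : ptopologicalType) :
  @second_countable U -> @second_countable V ->
  forall A : set (borel (U * V)%type), measurable A ->
    measurable (A : set (borel U * borel V)%type).
Proof.
move=> [B cB [Bo Bb]] [D cD [Do Db]].
apply: smallest_sub; first exact: sigma_algebra_measurable.
move=> O oO.
pose I := [set bd : set U * set V | [/\ B bd.1, D bd.2 & bd.1 `*` bd.2 `<=` O]].
have -> : O = \bigcup_(bd in I) (bd.1 `*` bd.2).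
  apply/seteqP; split=> [[u v] Ouv|uv [bd [_ _ bdO]]]; last exact: bdO.
  have [[P Q] /= [uP vQ] PQ] : nbhs (u, v) O by exact: open_nbhs_nbhs.
  have [b [Bb' bu] bP] := Bb u P uP; have [e [De ev] eQ] := Db v Q vQ.
  exists (b, e); last by [].
  by split => // -[x y] [/= bx ey]; apply: PQ; split; [exact: bP|exact: eQ].
rewrite bigcup_set_type; apply: countable_bigcupT_measurable.
  rewrite (eq_countable (card_setT _)).
  apply: sub_countable (countableX cB cD); apply: subset_card_le.
  by move=> -[b e] [].
move=> [[b e] /= /set_mem[/= Bb' De _]]; apply: measurableX.
- by apply: sub_sigma_algebra; exact: Bo.
- by apply: sub_sigma_algebra; exact: Do.
Qed.

Lemma continuous_borel_measurable (U V : ptopologicalType) (f : U -> V) :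
  continuous f -> measurable_fun setT (f : borel U -> borel V).
Proof.
move=> cf; apply: (@measurability _ _ (borel U) (borel V) setT f open) => //.
move=> _ [W oW <-]; rewrite setTI; apply: sub_sigma_algebra.
by move/continuousP : cf; apply.
Qed.

(** * Completing a partial coupling *)

Section coupling_completion.
Context {R : realType} (X Y : mmSpace R).
Notation plan := {finite_measure set (borel (X * Y)%type) -> \bar R}.

Lemma plan_radon (g : plan) : radon g.
Proof.
apply: compact_metric_radon.
- by apply: hausdorff_space_prod; exact: metric_hausdorff.
- by rewrite -setXTT; apply: compact_setX; exact: mm_compact.
Qed.

Lemma borel_fst_measurable :
  measurable_fun setT (fst : borel (X * Y)%type -> borel X).
Proof. by apply: continuous_borel_measurable; move=> x; exact: cvg_fst. Qed.

Lemma borel_snd_measurable :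
  measurable_fun setT (snd : borel (X * Y)%type -> borel Y).
Proof. by apply: continuous_borel_measurable; move=> x; exact: cvg_snd. Qed.

(** The product measure lives on the product of the Borel sigma-algebras; it is carried to the Borel
    sets of the product space by pushforward along the identity, measurable by second
    countability. *)
Lemma borel_prod_measure (a : {finite_measure set (borel X) -> \bar R})
    (b : {finite_measure set (borel Y) -> \bar R}) (c : {nonneg R}) :
  exists p : plan, forall (A : set (borel X)) (B : set (borel Y)),
    measurable A -> measurable B ->
    p (A `*` B) = (c%:num%:E * (a A * b B))%E.
Proof.
have mid : measurable_fun setT
    (fun z : (borel X * borel Y)%type => z : borel (X * Y)%type).
  move=> _ A mA; rewrite setTI; apply: second_countable_borel_prod => //.
  - by apply: compact_second_countable; exact: mm_compact.
  - by apply: compact_second_countable; exact: mm_compact.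
pose p0 : {measure set (borel X * borel Y)%type -> \bar R} :=
  mscale c (a \x b)%E.
have p0E A B : measurable A -> measurable B ->
    p0 (A `*` B) = (c%:num%:E * (a A * b B))%E.
  by move=> mA mB; rewrite -product_measure1E.
have p0T : (p0 setT < +oo)%E.
  by rewrite -setXTT p0E// ltey_eq !fin_numM// fin_num_measure.
have [p pE] := pushforward_finite_measure mid p0T.
by exists p => A B mA mB; rewrite pE -p0E.
Qed.

Lemma coupling_completion (g : plan) :
  mass (mm_measure X) = mass (mm_measure Y) -> partial_couplings X Y g ->
  exists g' n : plan, [/\ couplings X Y g',
    forall A, measurable A -> g' A = (g A + n A)%E &
    mass n = mass (mm_measure X) - mass g].
Proof.
move=> XY [_ g1 g2]; set t := mass (mm_measure X) - mass g.
have finT (p : plan) : (p setT < +oo)%E by rewrite -massE ltry.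
have [p1 p1E] := pushforward_finite_measure borel_fst_measurable (finT g).
have [p2 p2E] := pushforward_finite_measure borel_snd_measurable (finT g).
(* [a] and [b] are the parts of the two given measures that [g] leaves uncovered. Both have mass
   [t], because the two total masses agree. *)
have [|a aE] := @measure_difference _ _ _ (mm_measure X) p1.
  by move=> A mA; rewrite p1E; exact: g1.
have [|b bE] := @measure_difference _ _ _ (mm_measure Y) p2.
  by move=> A mA; rewrite p2E; exact: g2.
have aT : mass a = t.
  apply/eqP; rewrite eq_sym subr_eq -eqe EFinD !massE aE// p1E.
  by rewrite /pushforward preimage_setT addeC.
have bT : mass b = t.
  apply/eqP; rewrite /t XY eq_sym subr_eq -eqe EFinD !massE bE// p2E.
  by rewrite /pushforward preimage_setT addeC.
have t0 : 0 <= t by rewrite -aT mass_ge0.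
have ti0 : 0 <= t^-1 by rewrite invr_ge0.
have [n nE] := borel_prod_measure a b (NngNum ti0).
(* At t = 0 the junk value 0^-1 = 0 is harmless, since c vanishes too. *)
have tK d (T : measurableType d) (c : {finite_measure set T -> \bar R}) A :
    mass c = t -> measurable A -> (t^-1%:E * (c A * t%:E) = c A)%E.
  move=> cT mA.
  have cA : c A = (fine (c A))%:E by rewrite fineK// fin_num_measure.
  have [t00|tn0] := eqVneq t 0; last by rewrite cA -!EFinM mulrCA mulVf// mulr1.
  rewrite t00 mule0 mule0; apply/esym/eqP; rewrite -measure_le0.
  have <- : c setT = 0%E by rewrite -massE cT t00.
  by apply: le_measure => //; rewrite inE.
pose pX : borel (X * Y)%type -> borel X := fst.
pose pY : borel (X * Y)%type -> borel Y := snd.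
(* The factor [t^-1] cancels the mass of the other residual, so the marginals of [n] are exactly [a]
   and [b]. *)
have nX A : measurable A -> n (pX @^-1` A) = a A.
  move=> mA; have -> : pX @^-1` A = A `*` [set: borel Y].
    by apply/seteqP; split=> -[x y] //= [].
  by rewrite nE// -massE bT tK.
have nY A : measurable A -> n (pY @^-1` A) = b A.
  move=> mA; have -> : pY @^-1` A = [set: borel X] `*` A.
    by apply/seteqP; split=> -[x y] //= [].
  by rewrite nE// -massE aT [X in (_ * X)%E]muleC tK.
have gnT : (measure_add g n setT < +oo)%E.
  by rewrite measure_addE; exact: lte_add_pinfty (finT g) (finT n).
have [g' g'E] := finite_measure_of_measure gnT.
have {}g'E A : g' A = (g A + n A)%E by rewrite g'E; exact: measure_addE.
exists g', n; split; last 2 first.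
- by move=> A _; exact: g'E.
- by rewrite -aT /mass -(nX _ measurableT) preimage_setT.
split; first exact: plan_radon.
- by move=> A mA; rewrite /marginal1 /pushforward g'E nX// aE// p1E.
- by move=> A mA; rewrite /marginal2 /pushforward g'E nY// bE// p2E.
Qed.

(** The linear cost is charged at most [Cmax] on the added mass [n], the quadratic one at most
    [Lmax] on the two error products [g \x n] and [n \x g']. *)
Lemma fused_cost_add_le (C : X * Y -> R) (L : R * R -> R)
    (w1 w2 r Cmax Lmax : R) (g g' n : plan) :
  (forall z, 0 <= C z <= Cmax) ->
  (forall z z' : X * Y, 0 <= distortion L r z z' <= Lmax) -> 0 <= w1 -> 0 <= w2 ->
  (forall A, measurable A -> g' A = (g A + n A)%E) ->
  (fused_cost X Y C L w1 w2 r g' <= fused_cost X Y C L w1 w2 r g +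
    (w1 * (Cmax * mass n) +
     w2 * (Lmax * (mass g * mass n + mass n * mass g')))%:E)%E.
Proof.
move=> hC hL w10 w20 g'E; rewrite /fused_cost.
have C0 z : 0 <= C z by have /andP[] := hC z.
have L0 (z z' : X * Y) : 0 <= distortion L r z z' by have /andP[] := hL z z'.
have intC : (\int[g']_z (C z)%:E <=
    \int[g]_z (C z)%:E + (Cmax * mass n)%:E)%E.
  rewrite EFinM massE; apply: integral_measure_add_le => // z.
  by have /andP[] := hC z.
have intL : (\int[g' \x g']_zz (distortion L r zz.1 zz.2)%:E <=
    \int[g \x g]_zz (distortion L r zz.1 zz.2)%:E +
    (Lmax * (mass g * mass n + mass n * mass g'))%:E)%E.
  have -> : ((Lmax * (mass g * mass n + mass n * mass g'))%:E =
      Lmax%:E * measure_add (g \x n) (n \x g') setT)%E.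
    have pT (p q : plan) : (mass p * mass q)%:E = (p \x q)%E setT.
      by rewrite EFinM !massE -product_measure1E// setXTT.
    by rewrite EFinM EFinD !pT; congr (_ * _)%E; exact/esym/measure_addE.
  apply: (@integral_measure_add_le _ _ _ (g' \x g')%E (g \x g)%E) => //.
  - move=> A mA; apply: etrans (product_measure_add g'E mA) _.
    by congr (_ + _)%E; exact/esym/measure_addE.
  - by move=> zz; have /andP[] := hL zz.1 zz.2.
rewrite EFinD !(EFinM w1, EFinM w2) addeACA; apply: leeD.
- apply: le_trans (lee_wpmul2l _ intC) _; first by rewrite lee_fin.
  by rewrite muleDr// fin_num_adde_defl.
- apply: le_trans (lee_wpmul2l _ intL) _; first by rewrite lee_fin.
  by rewrite muleDr// fin_num_adde_defl.
Qed.

End coupling_completion.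

(** * Equality of the two infima *)

Theorem propositionK5 (R : realType) (X Y : mmSpace R)
    (C : X * Y -> R) (L : R * R -> R) (w1 w2 r lam Cmax Lmax : R)
    (hC0 : forall z, 0 <= C z) (hL0 : forall s, 0 <= L s)
    (hCsc : lower_semicontinuous (fun z : X * Y => (C z)%:E))
    (hLsc : lower_semicontinuous (fun s : R * R => (L s)%:E))
    (hCmax : is_maximum C Cmax)
    (hLmax : is_maximum
       (fun zz : (X * Y) * (X * Y) => distortion L r zz.1 zz.2) Lmax)
    (hw1 : 0 <= w1) (hw2 : 0 <= w2) (hw : w1 + w2 = 1)
    (hmass : mass (mm_measure X) = mass (mm_measure Y))
    (hmass0 : 0 < mass (mm_measure X))
    (hr : 1 <= r) (hlam : 0 < lam)
    (hbound : w1 * (1 / Num.min (mass (mm_measure X)) (mass (mm_measure Y))) * Cmax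
              + w2 * Lmax <= 2 * lam) :
  FPGW X Y C L w1 w2 r lam = FGW X Y C L w1 w2 r.
Proof.
have massE1 g : couplings X Y g -> mass g = mass (mm_measure X).
  by move=> [_ gX _]; rewrite /mass -gX.
apply/eqP; rewrite eq_le; apply/andP; split.
  apply/ereal_infP => _ [g gXY <-]; apply: ereal_inf_lbound; exists g.
    by case: gXY => rg gX gY; split=> // A mA; rewrite (gX, gY).
  rewrite (massE1 g gXY) -hmass.
  by rewrite (_ : lam * _ = 0) ?adde0//; ring.
apply/ereal_infP => _ [g gXY <-].
have [g' [n [g'XY g'E nE]]] := coupling_completion hmass gXY.
apply: (@le_trans _ _ (fused_cost X Y C L w1 w2 r g')).
  by apply: ereal_inf_lbound; exists g'.
have [[z0 Cz0] CM] := hCmax; have [[zz0 Lzz0] LM] := hLmax.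
apply: le_trans (fused_cost_add_le (Cmax := Cmax) (Lmax := Lmax) _ _ hw1 hw2 g'E) _.
- by move=> z; rewrite hC0 CM.
- by move=> z z'; rewrite hL0 (LM (z, z')).
(* Cancelling the cost of [g] leaves a real inequality: the two cost increases against the penalty
   of [g]. *)
rewrite leeD2l// lee_fin nE (massE1 g' g'XY) -hmass.
move: hbound; rewrite -hmass minxx div1r.
set M := mass (mm_measure X); set m := mass g.
move=> hb.
have M0 : 0 < M by [].
have m0 : 0 <= m by exact: mass_ge0.
have t0 : 0 <= M - m by rewrite -nE mass_ge0.
have C0 : 0 <= Cmax by rewrite -Cz0.
(* The bound on [lam] multiplied by [M], which clears the inverse of the minimum of the two equal
   masses. *)
have hbM : w1 * Cmax <= (2 * lam - w2 * Lmax) * M.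
  have := ler_wpM2r (ltW M0) hb.
  rewrite mulrDl mulrAC divfK ?gt_eqF// => h; lra.
have s0 : 0 <= 2 * lam - w2 * Lmax.
  have : 0 <= w1 * M^-1 * Cmax by rewrite !mulr_ge0// invr_ge0 ltW.
  lra.
(* Enlarging [M] to [M + m] is allowed by the sign [s0]. Multiplying by [M - m] then produces
   [M^2 - m^2], the factor common to the penalty and to the quadratic increase. *)
have hbMm : w1 * Cmax <= (2 * lam - w2 * Lmax) * (M + m) by nra.
have := ler_wpM2r t0 hbMm; nra.
Qed.
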